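(* Let $L_{\mathcal P}=\{u\in\{0,1\}^+\mid u=u^R\}$ be the language of non-empty binary palindromes. Then every graph is $L_{\mathcal P}$-representable.
   Context: Graphs are finite, undirected and simple: $G=(V,E)$ with $V$ a finite non-empty set and $E\subseteq\binom{V}{2}$. $u^R$ is the reversal of the word $u$. A language $L\subseteq\{0,1\}^*$ is $0$-$1$-symmetric if it is invariant under the morphism exchanging $0$ and $1$ (the language here is). For distinct letters $u,v$ of an alphabet $V$, $h_{u,v}:V^*\to\{0,1\}^*$ is the monoid morphism with $u\mapsto 0$, $v\mapsto 1$, and $x\mapsto\lambda$ (empty word) for all other letters $x$. For a $0$-$1$-symmetric $L$ and a word $w\in V^*$ in which every letter of $V$ occurs, $G(L,w)$ is the graph with vertex set $V$ in which distinct $u,v$ are adjacent if and only if $h_{u,v}(w)\in L$. A graph $G=(V,E)$ is $L$-representable if $G=G(L,w)$ for some $w\in V^*$ in which every letter of $V$ occurs. *)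

(* Defs.v *)
From HB Require Import structures.
From mathcomp Require Import all_boot.

Set Implicit Arguments.
Unset Strict Implicit.
Unset Printing Implicit Defensive.

Record graph (V : finType) := Graph {
  edges :> {set {set V}};
  edges_card2 : edges \subset [set e : {set V} | #|e| == 2]
}.

HB.instance Definition _ (V : finType) := [isSub for @edges V].

Definition adjacent (V : finType) (G : graph V) : rel V :=
  fun u v => [set u; v] \in edges G.

(* Words over {0,1} are boolean sequences, with 0 = false and 1 = true. *)
Definition language := {pred seq bool}.

Definition zero_one_symmetric (L : language) : Prop :=
  forall s : seq bool, (map negb s \in L) = (s \in L).

(* The morphism h_{u,v}; it is only meant to be used for u != v. *)
Definition proj_word (V : eqType) (u v : V) (w : seq V) : seq bool :=
  pmap (fun x => if x == u then Some false
                 else if x == v then Some true else None) w.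

Definition word_edges (V : finType) (L : language) (w : seq V) :
    {set {set V}} :=
  [set [set p.1; p.2] | p : V * V &
     (p.1 != p.2) && (proj_word p.1 p.2 w \in L)].

Fact word_edges_card2 (V : finType) (L : language) (w : seq V) :
  word_edges L w \subset [set e : {set V} | #|e| == 2].
Proof.
apply/subsetP=> e /imsetP[[u v]]; rewrite inE /= => /andP[uv _] ->.
by rewrite inE cards2 uv.
Qed.

(* The graph G(L,w). The order in which the ends of an edge are listed is
   irrelevant exactly because L is 0-1-symmetric: see word_graphE. *)
Definition word_graph (V : finType) (L : language) (w : seq V) : graph V :=
  Graph (word_edges_card2 L w).

Definition representable (V : finType) (L : language) (G : graph V) : Prop :=
  exists w : seq V, (forall x : V, x \in w) /\ G = word_graph L w.

Definition palindromes : language :=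
  [pred s : seq bool | (s != [::]) && (s == rev s)].

Fact palindromes_symmetric : zero_one_symmetric palindromes.
Proof.
move=> s; rewrite !inE -map_rev (inj_eq (inj_map negb_inj)).
by case: s.
Qed.

Lemma proj_wordC (V : eqType) (u v : V) (w : seq V) :
  u != v -> proj_word v u w = map negb (proj_word u v w).
Proof.
move=> uv; elim: w => //= x w IH.
have [-> | xu] := eqVneq x u; first by rewrite (negbTE uv) /= IH.
by have [_ | _] := eqVneq x v; rewrite /= IH.
Qed.

Lemma word_graphE (V : finType) (L : language) (w : seq V) (u v : V) :
  zero_one_symmetric L -> u != v ->
  adjacent (word_graph L w) u v = (proj_word u v w \in L).
Proof.
move=> symL uv; apply/imsetP/idP => [[[a b]]|Luv]; last first.
  by exists (u, v); rewrite ?inE /= ?uv.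
rewrite inE /= => /andP[ab Lab] eq_e.
have: u \in [set a; b] by rewrite -eq_e set21.
have: v \in [set a; b] by rewrite -eq_e set22.
rewrite !inE => /orP[] /eqP ev /orP[] /eqP eu; move: uv; rewrite ev eu ?eqxx //.
by move=> ba; rewrite (proj_wordC _ ab) symL.
Qed.

(* Main.v *)
Require Import Defs.
From mathcomp Require Import all_boot.

(** A word of the form [r ++ rev r] has only palindromic projections. Replacing
    [w] by [a b w a b] makes the projection to [a, b] a non-palindrome of the
    form [01...01], while the projection to any other pair of letters is
    unchanged or gains the same letter at both ends. Doing this once for every
    non-edge [ab] yields the required word. *)

Set Implicit Arguments.
Unset Strict Implicit.
Unset Printing Implicit Defensive.

Definition bracket (V : Type) (p : V * V) (w : seq V) : seq V :=
  [:: p.1, p.2 & w ++ [:: p.1; p.2]].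

Lemma pmap_rev (A B : Type) (f : A -> option B) (s : seq A) :
  pmap f (rev s) = rev (pmap f s).
Proof.
elim: s => //= x s IH; rewrite rev_cons -cats1 pmap_cat IH /=.
by case: (f x) => [y|] /=; rewrite ?rev_cons ?cats1 ?cats0.
Qed.

(** Settles the non-emptiness clause of [palindromes], so that only invariance under reversal
    remains to be studied. *)
Lemma proj_word_neq0 (V : eqType) (u v : V) (w : seq V) :
  u \in w -> proj_word u v w != [::].
Proof.
by elim: w => //= x w IH; rewrite inE eq_sym; case: (x == u); case: (x == v).
Qed.

Lemma rev_eq_ends (T : eqType) (x : T) (s : seq T) :
  (x :: s ++ [:: x] == rev (x :: s ++ [:: x])) = (s == rev s).
Proof. by rewrite rev_cons rev_cat /= eqseq_cons eqxx cats1 eqseq_rcons eqxx andbT. Qed.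

Lemma proj_bracket_palindrome (V : finType) (u v : V) (p : V * V) (w : seq V) :
  u != v -> p.1 != p.2 ->
  let h := proj_word u v in
  (h (bracket p w) == rev (h (bracket p w))) =
    ([set p.1; p.2] != [set u; v]) && (h w == rev (h w)).
Proof.
case: p => a b /= uv ab; rewrite /bracket /proj_word /= pmap_cat /=.
(* Expressed by the same letter tests as the projection, so that one case analysis evaluates both
   sides. *)
have set_eq : ([set a; b] == [set u; v]) =
              ((a == u) && (b == v)) || ((a == v) && (b == u)).
  apply/eqP/orP => [eq_ab|[] /andP[/eqP-> /eqP->] //]; last exact: setUC.
  have: a \in [set u; v] by rewrite -eq_ab set21.
  have: b \in [set u; v] by rewrite -eq_ab set22.
  rewrite !inE => /orP[] /eqP eb /orP[] /eqP ea; move: ab; rewrite ea eb ?eqxx //.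
  - by right.
  - by left.
rewrite set_eq; move: ab uv.
have [-> | au] := eqVneq a u; have [-> | bu] := eqVneq b u;
  rewrite ?eqxx //=.
- move=> _ uv; rewrite (negbTE uv) andbF orbF.
  have [_ | _] := eqVneq b v; last exact: rev_eq_ends.
  (* The word begins and ends with 01, so its reversal begins with 1 and differs at the first
     letter. *)
  by rewrite rev_cons rev_cons rev_cat.
- move=> _ uv; have [_ | _] := eqVneq a v; last exact: rev_eq_ends.
  by rewrite rev_cons rev_cons rev_cat.
(* Without [u], at most one of [a] and [b] survives the projection. *)
have [-> | av] := eqVneq a v; have [_ | bv] := eqVneq b v;
  rewrite ?eqxx //= => _ _; try exact: rev_eq_ends.
by rewrite cats0.
Qed.

(** Brackets do not interfere: an outer one never repairs a palindrome broken further in, so the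
    conditions of the single brackets combine into a conjunction. *)
Lemma proj_foldr_bracket_palindrome (V : finType) (u v : V) (r : seq V)
    (s : seq (V * V)) :
  u != v -> all (fun p => p.1 != p.2) s ->
  let h := proj_word u v (foldr (@bracket V) (r ++ rev r) s) in
  (h == rev h) = all (fun p => [set p.1; p.2] != [set u; v]) s.
Proof.
move=> uv; elim: s => [_|p s IH /= /andP[p12 /IH {}IH]] /=.
  by rewrite /proj_word pmap_cat pmap_rev rev_cat revK eqxx.
by rewrite (proj_bracket_palindrome _ uv p12) IH.
Qed.

Lemma mem_foldr_bracket (V : eqType) (x : V) (w : seq V) (s : seq (V * V)) :
  x \in w -> x \in foldr (@bracket V) w s.
Proof.
by move=> xw; elim: s => //= p s IH; rewrite !inE mem_cat IH !orbT.
Qed.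

(** A set that does not have two elements lies in neither edge set. *)
Lemma graph_eqP (V : finType) (G H : graph V) :
  (forall u v, u != v -> adjacent G u v = adjacent H u v) -> G = H.
Proof.
move=> eqGH; apply/val_inj/setP => /= e.
have [/cards2P[u [v [uv ->]]] | e2] := boolP (#|e| == 2); first exact: eqGH.
have notin (K : graph V) : e \notin edges K.
  by apply: contra e2 => /(subsetP (edges_card2 K)); rewrite inE.
by rewrite (negbTE (notin G)) (negbTE (notin H)).
Qed.

Theorem theorem9 (V : finType) (V_nonempty : 0 < #|V|) (G : graph V) :
  representable palindromes G.
Proof.
(* Each non-edge is listed in both orders; the second bracket is harmless, as the palindrome stays
   broken. *)
pose s := [seq p <- enum {: V * V} |
            (p.1 != p.2) && ([set p.1; p.2] \notin edges G)].
pose w := foldr (@bracket V) (enum V ++ rev (enum V)) s.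
have memw x : x \in w by rewrite mem_foldr_bracket // mem_cat mem_enum.
exists w; split=> //; apply: graph_eqP => u v uv.
rewrite (word_graphE _ palindromes_symmetric uv) inE proj_word_neq0 //=.
have s12 : all (fun p => p.1 != p.2) s.
  by apply/allP => p; rewrite mem_filter -andbA => /andP[].
rewrite (proj_foldr_bracket_palindrome _ uv s12) /adjacent.
apply/idP/allP => [uvG p | s_uv].
  rewrite mem_filter -andbA => /and3P[_ pG _].
  by apply: contraNneq pG => ->.
apply: contraT => uvG; have := s_uv (u, v).
by rewrite mem_filter /= uv uvG mem_enum eqxx => /(_ isT).
Qed.
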